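(* The system $\mathbf L_C$ of classical propositional logics and, for every set $V$ of variables, the system $\mathbf L_{FOL}(V)$ of first-order logics have the patchwork property of models.
   Context: $\mathbf L_C=\langle\mathcal{CPL}(P): P\in\mathrm{Sig}\rangle$ with $\mathrm{Sig}$ the class of sets containing no proper terms over $\{\wedge,\neg,\bot\}$; $\mathcal{CPL}(P)$ has connectives $\wedge,\neg,\bot$, atomic formulas $P$, models $\mathfrak M:P\to\{0,1\}$ extended to formulas classically, $\mathrm{mng}_{\mathfrak M}(\phi)=\mathfrak M(\phi)$, $\mathfrak M\models\phi$ iff $\mathfrak M(\phi)=1$. First-order logic $\mathcal{FOL}_t(V)$ for a relational similarity type $t$ (arities $\ge1$) and variable set $V$: atomic formulas $P_t(V)=\{r(v_1,\dots,v_n):r\in\mathrm{dom}(t),t(r)=n,v_i\in V\}$; connectives $\wedge$, $\neg$, $\exists v$ ($v\in V$), constants $\bot$ and $v=w$ ($v,w\in V$); models are $t$-structures $\mathfrak M$ with universe $M$; $\mathrm{mng}_{\mathfrak M}(\phi)=\{h\in{}^VM:\mathfrak M\models\phi[h]\}$; $\mathfrak M\models\phi$ iff $\phi$ holds under all assignments. For nonempty $V$, $\mathrm{Sig}(V)=\{P_t(V): t$ a nonempty relational similarity type$\}$ (each $P_t(V)$ determines $t$) and $\mathbf L_{FOL}(V)=\langle\mathcal{FOL}_t(V):P_t(V)\in\mathrm{Sig}(V)\rangle$; for $V=\emptyset$, $\mathrm{Sig}(\emptyset)=\{\emptyset\}$ and $\mathbf L_{FOL}(\emptyset)$ consists of $\mathcal{FOL}_\emptyset(\emptyset)$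 only. For a system $\mathbf L=\langle\mathcal L^P:P\in\mathrm{Sig}\rangle$ of logics (with formula algebras $\mathfrak F^P$, universes $F^P$, model classes $M^P$, meaning functions $\mathrm{mng}^P$; $F^{R}$ for $R\subseteq P$ denotes the subalgebra of formulas built from $R$): the patchwork property of models holds if whenever $P_i\in\mathrm{Sig}$ ($i\in I$), $P=\bigcup_iP_i\in\mathrm{Sig}$, and $\mathfrak M_i\in M^{P_i}$ satisfy $\mathrm{mng}^{P_i}_{\mathfrak M_i}\upharpoonright F^{P_i\cap P_j}=\mathrm{mng}^{P_j}_{\mathfrak M_j}\upharpoonright F^{P_i\cap P_j}$ for all $i,j$ with $F^{P_i\cap P_j}\ne\emptyset$, there is $\mathfrak M\in M^P$ with $\mathrm{mng}^P_{\mathfrak M}\upharpoonright F^{P_i}=\mathrm{mng}^{P_i}_{\mathfrak M_i}$ for all $i\in I$. *)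

(* Defs.v *)
From mathcomp Require Import all_boot.
From mathcomp Require Import boolp classical_sets.

Set Implicit Arguments.
Unset Strict Implicit.
Unset Printing Implicit Defensive.

Local Open Scope classical_set_scope.

(* Terms over the connectives [C], of arities [ar], with generators in [A].
   Generators are kept apart from proper terms by the constructor [Atom], so
   that no set of generators contains a proper term. *)
Inductive term (C : Type) (ar : C -> nat) (A : Type) : Type :=
| Atom of A
| Op (c : C) of ('I_(ar c) -> term ar A).

Arguments Atom {C ar A}.
Arguments Op {C ar A}.

(* The universe F^R of the subalgebra generated by R.  It is empty when R is
   empty and there is no constant among the connectives. *)
Inductive formulas (C : Type) (ar : C -> nat) (A : Type) (R : set A) :
    set (term ar A) :=
| formulas_atom a : R a -> formulas R (Atom a)
| formulas_op c (args : 'I_(ar c) -> term ar A) :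
    (forall i, formulas R (args i)) -> formulas R (Op c args).

(* A system < L^P : P in Sig > of logics.  All signatures are sets of elements
   of one type [atom], so that unions and intersections of signatures and
   inclusions of formula algebras make sense.  The formula algebra of L^P has
   universe [formulas P]; the values of [mng P] and [valid P] outside
   [formulas P] carry no information. *)
Record logic_system : Type := LogicSystem {
  atom : Type;
  conn : Type;
  arity : conn -> nat;
  meaning : Type;
  Sig : set (set atom);
  model : set atom -> Type;
  mng : forall P : set atom, model P -> term arity atom -> meaning;
  valid : forall P : set atom, model P -> term arity atom -> Prop
}.

Arguments arity : clear implicits.
Arguments Sig : clear implicits.
Arguments model : clear implicits.
Arguments mng {l P}.
Arguments valid {l P}.

Definition patchwork_property (L : logic_system) : Prop :=
  forall (I : Type) (P_ : I -> set (atom L)) (M_ : forall i, model L (P_ i)),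
    (forall i, Sig L (P_ i)) ->
    Sig L (\bigcup_i P_ i) ->
    (forall i j,
       @formulas _ (arity L) _ (P_ i `&` P_ j) !=set0 ->
       forall phi, formulas (P_ i `&` P_ j) phi ->
         mng (M_ i) phi = mng (M_ j) phi) ->
    exists M : model L (\bigcup_i P_ i),
      forall i phi, formulas (P_ i) phi -> mng M phi = mng (M_ i) phi.

Section ClassicalPropositionalLogic.
Variable A : Type.

Inductive cpl_conn : Type := CAnd | CNot | CBot.

Definition cpl_arity (c : cpl_conn) : nat :=
  match c with CAnd => 2 | CNot => 1 | CBot => 0 end.

Definition cpl_op (c : cpl_conn) : ('I_(cpl_arity c) -> bool) -> bool :=
  match c with
  | CAnd => fun b => b ord0 && b ord_max
  | CNot => fun b => ~~ b ord0
  | CBot => fun=> false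
  end.

Definition cpl_model (P : set A) : Type := {p : A | P p} -> bool.

Fixpoint cpl_val (P : set A) (M : cpl_model P) (phi : term cpl_arity A) :
    bool :=
  match phi with
  | Atom p => if pselect (P p) is left Pp then M (exist _ p Pp) else false
  | Op c args => cpl_op (fun i => cpl_val M (args i))
  end.

Definition L_C : logic_system := {|
  Sig := setT;
  model := cpl_model;
  mng := cpl_val;
  valid := fun P M phi => cpl_val M phi = true
|}.

End ClassicalPropositionalLogic.

(* [Rel] is the type from which relation symbols are drawn; a similarity type
   is a partial function from it to the positive natural numbers. *)
Record simtype (Rel : Type) : Type := SimType {
  rank :> Rel -> option nat;
  rank_gt0 : forall r n, rank r = Some n -> 0 < n
}.

Definition dom (Rel : Type) (t : simtype Rel) : set Rel :=
  [set r | exists n, t r = Some n].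

(* Universes are nonempty subsets of a fixed type [U], so that meanings in
   different structures, with different universes, can be compared. *)
Record structure (Rel U : Type) (t : simtype Rel) : Type := Structure {
  univ : set U;
  univ_neq0 : univ !=set0;
  interp : forall r n, t r = Some n -> set (n.-tuple U);
  interp_univ : forall r n (e : t r = Some n) (x : n.-tuple U),
    interp e x -> forall k, univ (tnth x k)
}.

Section FirstOrderLogic.
Variables (V Rel U : Type).

(* The pair (r, [:: v_1; ...; v_n]) is the atomic formula r(v_1, ..., v_n). *)
Definition fol_atom : Type := (Rel * seq V)%type.

(* The set P_t(V). *)
Definition fol_atoms (t : simtype Rel) : set fol_atom :=
  [set a | t a.1 = Some (size a.2)].

Inductive fol_conn : Type :=
| FAnd | FNot | FEx of V | FBot | FEq of V & V.

Definition fol_arity (c : fol_conn) : nat :=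
  match c with FAnd => 2 | FNot => 1 | FEx _ => 1 | FBot => 0 | FEq _ _ => 0 end.

Definition update (h : V -> U) (v : V) (a : U) : V -> U :=
  fun w => if `[< w = v >] then a else h w.

Definition sat_op (D : set U) (c : fol_conn) :
    ('I_(fol_arity c) -> (V -> U) -> Prop) -> (V -> U) -> Prop :=
  match c with
  | FAnd => fun S h => S ord0 h /\ S ord_max h
  | FNot => fun S h => ~ S ord0 h
  | FEx v => fun S h => exists2 a, D a & S ord0 (update h v a)
  | FBot => fun _ _ => False
  | FEq v w => fun _ h => h v = h w
  end.

Fixpoint sat (t : simtype Rel) (M : structure U t)
    (phi : term fol_arity fol_atom) : (V -> U) -> Prop :=
  match phi with
  | Atom (r, vs) => fun h =>
      exists e : t r = Some (size vs), interp M e (map_tuple h (in_tuple vs))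
  | Op c args => sat_op (univ M) (fun i => sat M (args i))
  end.

Definition assignment (t : simtype Rel) (M : structure U t) : set (V -> U) :=
  [set h | forall v, univ M (h v)].

Definition fol_mng (t : simtype Rel) (M : structure U t)
    (phi : term fol_arity fol_atom) : set (V -> U) :=
  [set h | assignment M h /\ sat M phi h].

Definition fol_valid (t : simtype Rel) (M : structure U t)
    (phi : term fol_arity fol_atom) : Prop :=
  forall h, assignment M h -> sat M phi h.

(* The similarity types t for which FOL_t(V) belongs to the system: the
   nonempty ones if V is nonempty, and only the empty one otherwise. *)
Definition admissible (t : simtype Rel) : Prop :=
  (inhabited V -> dom t !=set0) /\ (~ inhabited V -> dom t = set0).

Definition fol_Sig : set (set fol_atom) :=
  [set P | exists2 t, admissible t & P = fol_atoms t].

(* Models for the signature P are the t-structures, for the t (unique among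
   the admissible types) such that P = P_t(V). *)
Record fol_model (P : set fol_atom) : Type := FolModel {
  fol_type : simtype Rel;
  fol_type_adm : admissible fol_type;
  fol_typeP : P = fol_atoms fol_type;
  fol_structure :> structure U fol_type
}.

Definition L_FOL : logic_system := {|
  Sig := fol_Sig;
  model := fol_model;
  mng := fun P (M : fol_model P) => fol_mng M;
  valid := fun P (M : fol_model P) => fol_valid M
|}.

End FirstOrderLogic.

(* Main.v *)
From mathcomp Require Import all_boot.
From mathcomp Require Import boolp classical_sets.
Require Import Defs.

(** Meaning functions are homomorphisms from the formula algebra, so they are
    determined by their values on atoms, and it suffices to patch the meanings
    of atoms.  An atom outside the signature of a model has the least meaning
    (false, or the empty set), so the patched model gives to each atom the
    supremum of its meanings in the given models; compatibility says that all
    models whose signature contains the atom contribute the same meaning.  In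
    the first-order case the operations of the meaning algebra depend on the
    universe.  If there is a variable [v], then the meaning of [v = v]
    determines the universe, so compatible structures share it; if there is
    none, then the operations do not depend on the universe after all. *)

Set Implicit Arguments.
Unset Strict Implicit.
Unset Printing Implicit Defensive.

Local Open Scope classical_set_scope.

Definition agree_on (C : Type) (ar : C -> nat) (A B : Type) (R : set A)
    (f g : term ar A -> B) : Prop :=
  forall phi, formulas R phi -> f phi = g phi.

Lemma hom_agree_on (C : Type) (ar : C -> nat) (A B : Type)
    (op : forall c, ('I_(ar c) -> B) -> B) (R : set A) (f g : term ar A -> B) :
  (forall c args, f (Op c args) = op c (f \o args)) ->
  (forall c args, g (Op c args) = op c (g \o args)) ->
  (forall a, R a -> f (Atom a) = g (Atom a)) ->
  agree_on R f g.
Proof.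
move=> fOp gOp fg phi; elim=> [//|c args _ IH].
by rewrite fOp gOp; congr op; apply/funext.
Qed.

Definition compatible (L : logic_system) (I : Type) (P_ : I -> set (atom L))
    (M_ : forall i, model L (P_ i)) : Prop :=
  forall i j, agree_on (P_ i `&` P_ j) (mng (M_ i)) (mng (M_ j)).

Lemma patchwork_of_compatible (L : logic_system) :
  (forall (I : Type) (P_ : I -> set (atom L)) (M_ : forall i, model L (P_ i)),
     Sig L (\bigcup_i P_ i) -> compatible M_ ->
     exists M : model L (\bigcup_i P_ i),
       forall i, agree_on (P_ i) (mng M) (mng (M_ i))) ->
  patchwork_property L.
Proof.
move=> patch I P_ M_ _ SigP agree; apply: (patch I P_ M_ SigP) => i j phi Rphi.
exact: (agree i j (ex_intro _ phi Rphi) phi Rphi).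
Qed.

Section ClassicalPropositionalLogic.
Variable A : Type.

Lemma cpl_val_atomE (P : set A) (M : cpl_model P) (p : A) (Pp : P p) :
  cpl_val M (Atom p) = M (exist _ p Pp).
Proof.
by rewrite /=; case: pselect => // Pp'; rewrite (Prop_irrelevance Pp' Pp).
Qed.

Lemma cpl_val_atom_mem (P : set A) (M : cpl_model P) (p : A) :
  cpl_val M (Atom p) -> P p.
Proof. by rewrite /=; case: pselect. Qed.

Lemma cpl_val_agree_on (P Q R : set A) (M : cpl_model P) (N : cpl_model Q) :
  (forall p, R p -> cpl_val M (Atom p) = cpl_val N (Atom p)) ->
  agree_on R (cpl_val M) (cpl_val N).
Proof. exact: (hom_agree_on (op := cpl_op)). Qed.

Section Gluing.
Variables (I : Type) (P_ : I -> set A) (M_ : forall i, cpl_model (P_ i)).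
Arguments M_ : clear implicits.

Definition cpl_glue : cpl_model (\bigcup_i P_ i) :=
  fun p => `[< exists i, cpl_val (M_ i) (Atom (sval p)) >].

Hypothesis compatM : compatible (L := L_C A) M_.

Lemma cpl_val_glue (i : I) :
  agree_on (P_ i) (cpl_val cpl_glue) (cpl_val (M_ i)).
Proof.
apply: cpl_val_agree_on => p Pip.
have Pp : (\bigcup_i P_ i) p by exists i.
rewrite (cpl_val_atomE _ Pp).
apply/asboolP/idP => [[j Mjp]|Mip]; last by exists i.
suff <- : cpl_val (M_ j) (Atom p) = cpl_val (M_ i) (Atom p) by [].
apply: compatM; apply: formulas_atom; split=> //.
exact: cpl_val_atom_mem Mjp.
Qed.

End Gluing.

Lemma L_C_patchwork : patchwork_property (L_C A).
Proof.
apply: patchwork_of_compatible => I P_ M_ _ compatM.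
by exists (cpl_glue M_); exact: cpl_val_glue.
Qed.

End ClassicalPropositionalLogic.

Section FirstOrderLogic.
Variables (V Rel U : Type).
Implicit Types (t : simtype Rel) (D : set U).

Definition assignments D : set (V -> U) := [set h | forall v, D (h v)].

Lemma assignments_inj D D' : V -> assignments D = assignments D' -> D = D'.
Proof.
move=> v eqDD'; apply/seteqP; split=> a Da.
- by have : assignments D (fun=> a) by []; rewrite eqDD' => /(_ v).
- by have : assignments D' (fun=> a) by []; rewrite -eqDD' => /(_ v).
Qed.

Lemma update_assignments D (h : V -> U) (v : V) (a : U) :
  assignments D h -> D a -> assignments D (update h v a).
Proof. by move=> hD Da w; rewrite /update; case: asboolP. Qed.

Definition fol_op D (c : fol_conn V)
    (X : 'I_(fol_arity c) -> set (V -> U)) : set (V -> U) :=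
  assignments D `&` sat_op D X.

Lemma fol_mng_Op t (M : structure U t) (c : fol_conn V)
    (args : 'I_(fol_arity c) -> term (@fol_arity V) (fol_atom V Rel)) :
  fol_mng M (Op c args) = fol_op (univ M) (fol_mng M \o args).
Proof.
suff sat_OpE h : assignments (univ M) h ->
    sat M (Op c args) h <-> sat_op (univ M) (fol_mng M \o args) h.
  by apply/seteqP; split=> h [hM sh]; split=> //; apply/sat_OpE.
case: c args => [||v||v w] args hM //=.
- by split=> [[s0 s1]|[[_ s0] [_ s1]]].
- by split=> [ns [_ /ns]|ns s0] //; apply: ns.
- split=> [[a Ma sa]|[a Ma [_ sa]]]; exists a => //.
  by split=> //; exact: update_assignments.
Qed.

Lemma eq_fol_op D D' (c : fol_conn V)
    (X : 'I_(fol_arity c) -> set (V -> U)) :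
  (V -> D = D') -> fol_op D X = fol_op D' X.
Proof.
move=> eqDD'; have [[v]|noV] := pselect (inhabited V).
  by rewrite (eqDD' v).
have eqA : assignments D = assignments D'.
  by apply/seteqP; split=> h _ v; case: noV.
by case: c X => [||v||v w] X; rewrite /fol_op eqA //; case: noV.
Qed.

Lemma fol_mng_agree_on t t' (M : structure U t) (N : structure U t')
    (R : set (fol_atom V Rel)) :
  (V -> univ M = univ N) ->
  (forall a, R a -> fol_mng M (Atom a) = fol_mng N (Atom a)) ->
  agree_on R (fol_mng M) (fol_mng N).
Proof.
move=> eqMN; apply: (hom_agree_on (op := fol_op (univ M))) => c args.
- exact: fol_mng_Op.
- by rewrite (eq_fol_op _ eqMN); exact: fol_mng_Op.
Qed.

Lemma fol_mng_FEq_refl t (M : structure U t) (v : V)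
    (args : 'I_0 -> term (@fol_arity V) (fol_atom V Rel)) :
  fol_mng M (Op (FEq v v) args) = assignments (univ M).
Proof. by apply/seteqP; split=> h; [case|]. Qed.

Lemma agree_on_univ t t' (M : structure U t) (N : structure U t')
    (R : set (fol_atom V Rel)) :
  agree_on R (fol_mng M) (fol_mng N) -> V -> univ M = univ N.
Proof.
move=> agreeMN v; apply: (assignments_inj v).
have args : 'I_0 -> term (@fol_arity V) (fol_atom V Rel) by case.
rewrite -(fol_mng_FEq_refl M v args) -(fol_mng_FEq_refl N v args).
by apply: agreeMN; apply: formulas_op => -[].
Qed.

Lemma fol_mng_atom_mem t (M : structure U t) (a : fol_atom V Rel)
    (h : V -> U) : fol_mng M (Atom a) h -> fol_atoms t a.
Proof. by case: a => r vs [_ []]. Qed.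

Lemma fol_model_inhabited (P : set (fol_atom V Rel)) :
  inhabited U -> fol_Sig P -> inhabited (fol_model U P).
Proof.
move=> [u] [t t_adm Pt].
have U_neq0 : [set: U] !=set0 by exists u.
have no_interp r n (_ : t r = Some n) (x : n.-tuple U) :
  set0 x -> forall k, [set: U] (tnth x k) by [].
exact: inhabits (FolModel t_adm Pt (Structure U_neq0 no_interp)).
Qed.

Section Gluing.
Variables (I : Type) (t_ : I -> simtype Rel).
Variables (M_ : forall i, structure U (t_ i)) (i0 : I) (t : simtype Rel).

Definition glue_univ : set U := \bigcup_i univ (M_ i).

Definition glue_interp r n (_ : t r = Some n) : set (n.-tuple U) :=
  [set x | exists i (e : t_ i r = Some n), interp (M_ i) e x].

Lemma glue_univ_neq0 : glue_univ !=set0.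
Proof. by have [u u_i0] := univ_neq0 (M_ i0); exists u, i0. Qed.

Lemma glue_interp_univ r n (e : t r = Some n) (x : n.-tuple U) :
  glue_interp e x -> forall k, glue_univ (tnth x k).
Proof. by move=> [i [ei xi]] k; exists i => //; exact: interp_univ xi k. Qed.

Definition fol_glue : structure U t :=
  Structure glue_univ_neq0 glue_interp_univ.

Hypothesis compatM : forall i j,
  agree_on (fol_atoms (V := V) (t_ i) `&` fol_atoms (t_ j))
    (fol_mng (M_ i)) (fol_mng (M_ j)).

Lemma fol_glue_univE (i : I) : V -> univ fol_glue = univ (M_ i).
Proof.
move=> v; apply/seteqP; split=> [u [j _]|u ui]; last by exists i.
by rewrite (agree_on_univ (@compatM i j) v).
Qed.

Lemma fol_glue_assignment (i : I) :
  assignment fol_glue = assignment (M_ i) :> set (V -> U).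
Proof.
apply/seteqP; split=> h hD v; have := hD v.
- by rewrite (fol_glue_univE i v).
- by rewrite -(fol_glue_univE i v).
Qed.

Lemma fol_mng_glue_atom (a : fol_atom V Rel) :
  fol_atoms t a ->
  fol_mng fol_glue (Atom a) = \bigcup_i fol_mng (M_ i) (Atom a).
Proof.
case: a => r vs e; apply/seteqP; split=> h.
- move=> [hG [_ [i [ei xi]]]]; exists i => //; split; last by exists ei.
  by rewrite -fol_glue_assignment.
- move=> [i _ [hi [ei xi]]]; split; last by exists e, i, ei.
  by rewrite (fol_glue_assignment i).
Qed.

Lemma fol_mng_glue (i : I) :
  fol_atoms (V := V) (t_ i) `<=` fol_atoms t ->
  agree_on (fol_atoms (V := V) (t_ i)) (fol_mng fol_glue) (fol_mng (M_ i)).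
Proof.
move=> sub_it; apply: fol_mng_agree_on => [|a ia]; first exact: fol_glue_univE.
rewrite (fol_mng_glue_atom (sub_it a ia)); apply/seteqP; split=> h.
- move=> [j _ ha].
  suff <- : fol_mng (M_ j) (Atom a) = fol_mng (M_ i) (Atom a) by [].
  apply: compatM; apply: formulas_atom; split=> //.
  exact: fol_mng_atom_mem ha.
- by exists i.
Qed.

End Gluing.

Lemma L_FOL_patchwork : inhabited U -> patchwork_property (L_FOL V Rel U).
Proof.
move=> U_inh; apply: patchwork_of_compatible => I P_ M_ SigP compatM.
have [[i0]|noI] := pselect (inhabited I); last first.
  by have [M] := fol_model_inhabited U_inh SigP; exists M => i; case: noI.
have [t t_adm Pt] := SigP.
exists (FolModel t_adm Pt (fol_glue M_ i0 t)) => i.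
rewrite [X in agree_on X](fol_typeP (M_ i)).
apply: (fol_mng_glue (M_ := fun j => M_ j)) => [j k|].
- by rewrite -!fol_typeP; exact: compatM.
- by rewrite -fol_typeP -Pt; exact: bigcup_sup.
Qed.

End FirstOrderLogic.

Theorem theorem5p2 :
  (forall A : Type, patchwork_property (L_C A)) /\
  (forall V Rel U : Type, inhabited U -> patchwork_property (L_FOL V Rel U)).
Proof. by split; [exact: L_C_patchwork|exact: L_FOL_patchwork]. Qed.
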